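(* Let $G$ be a graph with a partition of its vertex set into independent sets $V_1,V_2,\ldots,V_k$ such that $\phi(V_j,V_i)=\emptyset$ whenever $j>i$. Let $E$ be a set of edges of $G$ that is maximal (with respect to inclusion) subject to the following two conditions: (1) if $e=\{u,r\}\in E$ with $u\in V_i$ and $r\in V_j$, then $e$ is an isolated edge in the induced subgraph $G[V_i\cup V_j]$ (i.e., $\{u,r\}$ forms a connected component of $G[V_i\cup V_j]$); (2) if $e_1,e_2\in E$ share a common endpoint, then there is no triangle in $G$ containing both $e_1$ and $e_2$. Then $A=V_1V_1\cup V_2V_2\cup\cdots\cup V_kV_k\cup E$ is a maximal independent set in $T_2(G)$ (where each edge of $E$ is regarded as a $2$-subset of $V(G)$).
   Context: All graphs are finite and simple. The $2$-token graph $T_2(G)$ has as vertices the $2$-subsets of $V(G)$, two of them adjacent if their symmetric difference is an edge of $G$. For $A\subseteq V(G)$, $AA$ denotes the set of all 2-subsets of $A$. For disjoint independent sets $A,B$ of $G$, $\phi(A,B)=\{x\in A : B\cup\{x\} \text{ is an independent set of } G\}$. $G[W]$ denotes the subgraph induced by $W$. *)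

(* Defs.v *)
From HB Require Import structures.
From mathcomp Require Import all_boot.

Set Implicit Arguments.
Unset Strict Implicit.
Unset Printing Implicit Defensive.

Record sgraph := SGraph {
  vertex :> finType;
  adj : rel vertex;
  adj_sym : symmetric adj;
  adj_irrefl : irreflexive adj
}.

Section Graph.

Variable G : sgraph.
Implicit Types (A B t : {set G}).

Definition edges : {set {set G}} :=
  [set e | [exists x : G, exists y : G, adj x y && (e == [set x; y])]].

Definition independent A : bool :=
  [forall x in A, forall y in A, ~~ adj x y].

Definition maximal_independent A : bool := maxset independent A.

Definition components : {set {set G}} :=
  [set [set y | connect (@adj G) x y] | x : G].

Definition triangle t : bool :=
  (#|t| == 3) && [forall x in t, forall y in t, (x != y) ==> adj x y].

Definition phi A B : {set G} := [set x in A | independent (x |: B)].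

Definition pairs A : {set {set G}} :=
  [set P : {set G} | (P \subset A) && (#|P| == 2)].

End Graph.

Section Induced.

Variables (G : sgraph) (W : {set G}).

Definition induced_adj : rel {x : G | x \in W} :=
  [rel x y | adj (val x) (val y)].

Lemma induced_adj_sym : symmetric induced_adj.
Proof. by move=> x y; apply: adj_sym. Qed.

Lemma induced_adj_irrefl : irreflexive induced_adj.
Proof. by move=> x; apply: adj_irrefl. Qed.

Definition induced : sgraph := SGraph induced_adj_sym induced_adj_irrefl.

(* [e] lives in [G] and [f] is the same set seen inside the induced subgraph. *)
Definition isolated_edge_in (e : {set G}) : bool :=
  [exists f : {set induced},
    [&& [set val x | x in f] == e, f \in edges induced
      & f \in components induced]].

End Induced.

Section Token.

Variable G : sgraph.

Definition token2_adj : rel {P : {set G} | #|P| == 2} :=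
  [rel P Q | (val P :\: val Q) :|: (val Q :\: val P) \in edges G].

Lemma token2_adj_sym : symmetric token2_adj.
Proof. by move=> P Q; rewrite /token2_adj /= setUC. Qed.

Lemma token2_adj_irrefl : irreflexive token2_adj.
Proof.
move=> P; rewrite /token2_adj /= setDv setU0 inE.
apply/existsP => -[x /existsP[y /andP[_ /eqP/setP/(_ x)]]].
by rewrite !inE eqxx.
Qed.

Definition token2 : sgraph := SGraph token2_adj_sym token2_adj_irrefl.

End Token.

Section EdgeConditions.

Variables (G : sgraph) (k : nat) (V : 'I_k -> {set G}).

(* [partition] makes the blocks nonempty and distinct blocks disjoint, so
   injectivity of [V] says that the family itself is pairwise disjoint. *)
Definition vertex_partition : Prop :=
  injective V /\ partition [set V i | i : 'I_k] [set: G].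

Definition edges_isolated (E : {set {set G}}) : bool :=
  [forall u : G, forall r : G, forall i : 'I_k, forall j : 'I_k,
    [&& [set u; r] \in E, u \in V i & r \in V j]
      ==> isolated_edge_in (V i :|: V j) [set u; r]].

(* [e1] and [e2] must be distinct: an edge always shares its endpoints with
   itself, and it is not meant to be excluded merely for lying on a triangle. *)
Definition edges_triangle_free (E : {set {set G}}) : bool :=
  [forall e1 in E, forall e2 in E,
    (e1 != e2) && (e1 :&: e2 != set0) ==>
      ~~ [exists t : {set G},
           [&& triangle t, e1 \subset t & e2 \subset t]]].

Definition admissible_edges (E : {set {set G}}) : bool :=
  [&& E \subset edges G, edges_isolated E & edges_triangle_free E].

Definition token2_set (E : {set {set G}}) : {set token2 G} :=
  [set P : token2 G | val P \in (\bigcup_(i < k) pairs (V i)) :|: E].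

End EdgeConditions.

(* Main.v *)
Require Import Defs.
From HB Require Import structures.
From mathcomp Require Import all_boot.

Set Implicit Arguments.
Unset Strict Implicit.
Unset Printing Implicit Defensive.

(** Two 2-subsets are adjacent in T_2(G) iff they are {x, y} and {x, z} with
    y, z adjacent in G.  Independence of A is then immediate: condition (1)
    excludes an edge between a pair inside a class and a pair of E, condition
    (2) an edge between two pairs of E.

    For maximality let {u, r}, with u in V_i, r in V_j and i < j, have no
    neighbour in A.  As phi(V_j, V_i) is empty, r has a neighbour s in V_i; if
    s <> u then {u, s} in A is adjacent to {u, r}, so u is the only neighbour of
    r in V_i.  Likewise r is the only neighbour of u in V_j, hence {u, r} is an
    isolated edge of G[V_i U V_j].  If {u, r} were not in E, maximality of E
    would give a triangle through {u, r} and some e in E sharing an endpoint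
    with it, and then e would be a neighbour of {u, r} in A. *)

(** * Edges, triangles and isolated edges *)

Section Graph.

Variable G : sgraph.
Implicit Types (x y z u r : G) (e : {set G}).

Lemma adj_neq x y : adj x y -> x != y.
Proof. by apply: contraTneq => ->; rewrite adj_irrefl. Qed.

Lemma edgesP e :
  reflect (exists x y, adj x y /\ e = [set x; y]) (e \in edges G).
Proof.
rewrite inE; apply: (iffP existsP) => [[x /existsP[y /andP[xy /eqP->]]]|].
  by exists x, y.
by move=> [x [y [xy ->]]]; exists x; apply/existsP; exists y; rewrite xy eqxx.
Qed.

Lemma independentP (A : {set G}) :
  reflect {in A &, forall x y, ~~ adj x y} (independent A).
Proof.
apply: (iffP forall_inP) => [h x y xA yA|h x xA].
  by have /forall_inP := h x xA; apply.
by apply/forall_inP => y yA; apply: h.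
Qed.

Lemma adj_edges x y : ([set x; y] \in edges G) = adj x y.
Proof.
apply/edgesP/idP => [[a [b [ab E]]]|xy]; last by exists x, y.
have := adj_neq ab; have: a \in [set x; y] by rewrite E !inE eqxx.
have: b \in [set x; y] by rewrite E !inE eqxx orbT.
rewrite !inE => /orP[] /eqP eb /orP[] /eqP ea; subst a b; rewrite ?eqxx //.
by rewrite adj_sym.
Qed.

Lemma set2_inv x y a b :
  [set x; y] = [set a; b] -> (x = a /\ y = b) \/ (x = b /\ y = a).
Proof.
move=> E.
have: x \in [set a; b] by rewrite -E !inE eqxx.
have: y \in [set a; b] by rewrite -E !inE eqxx orbT.
have: a \in [set x; y] by rewrite E !inE eqxx.
have: b \in [set x; y] by rewrite E !inE eqxx orbT.
by rewrite !inE => /orP[]/eqP? /orP[]/eqP? /orP[]/eqP? /orP[]/eqP?; subst; auto.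
Qed.

Lemma cards2_neq x y : (#|[set x; y]| == 2) = (x != y).
Proof. by rewrite cards2; case: (x == y). Qed.

Lemma triangle_adj (t : {set G}) x y :
  triangle t -> x \in t -> y \in t -> x != y -> adj x y.
Proof.
by move=> /andP[_ /forall_inP h] xt yt; have /forall_inP/(_ y yt)/implyP := h x xt.
Qed.

Lemma triangle3 x y z : adj x y -> adj x z -> adj y z -> triangle [set x; y; z].
Proof.
move=> xy xz yz; apply/andP; split.
  have := adj_neq xz; have := adj_neq yz; have := adj_neq xy.
  rewrite setUC cardsU1 cards2 !inE negb_or (eq_sym z x) (eq_sym z y).
  by move=> -> -> ->.
apply/forall_inP => a; rewrite !inE -orbA => a3.
apply/forall_inP => b; rewrite !inE -orbA => b3.
apply/implyP.
by case/or3P: a3 => /eqP->; case/or3P: b3 => /eqP->; rewrite ?eqxx // adj_sym.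
Qed.

(** Components are closed under adjacency, and an edge closed under adjacency is a whole component;
    isolation thus becomes a condition on neighbours in [W]. *)
Lemma isolated_edgeP (W : {set G}) u r :
  u \in W -> r \in W -> adj u r ->
  reflect ({in W, forall y, adj u y -> y = r} /\
           {in W, forall y, adj r y -> y = u})
          (isolated_edge_in W [set u; r]).
Proof.
move=> uW rW ur; apply: (iffP existsP).
  move=> [f /and3P[/eqP fE _ /imsetP[c _ fc]]].
  have step a y : a \in [set u; r] -> y \in W -> adj a y -> y \in [set u; r].
    rewrite -fE => /imsetP[a' a'f ->] yW ay.
    apply/imsetP; exists (Sub y yW); last by rewrite SubK.
    move: a'f; rewrite fc !inE => /connect_trans; apply; apply: connect1.
    by rewrite /= /induced_adj /=.
  split=> y yW ay; have := step _ y _ yW ay; rewrite !inE eqxx ?orbT => /(_ isT).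
    by rewrite eq_sym (negPf (adj_neq ay)) => /eqP.
  by rewrite orbC eq_sym (negPf (adj_neq ay)) => /eqP.
move=> [uE rE].
pose u' : induced W := Sub u uW; pose r' : induced W := Sub r rW.
have ur' : @adj (induced W) u' r' by [].
exists [set u'; r']; apply/and3P; split.
- by rewrite imsetU1 imset_set1.
- by rewrite inE; apply/existsP; exists u'; apply/existsP; exists r'; apply/andP.
have csym : connect_sym (@adj (induced W)).
  by apply: sym_connect_sym; apply: adj_sym.
(* A closed set absorbs everything connected to [u'], so the component of [u'] cannot be larger than
   the edge. *)
have cl : closed (@adj (induced W)) [set u'; r'].
  apply: (intro_closed csym) => a b ab; rewrite !inE => /orP[]/eqP ea.
    apply/orP; right; apply/eqP/val_inj; apply: uE; first exact: valP.
    by move: ab; rewrite ea.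
  apply/orP; left; apply/eqP/val_inj; apply: rE; first exact: valP.
  by move: ab; rewrite ea.
apply/imsetP; exists u' => //; apply/setP => y; rewrite [in RHS]inE.
apply/idP/idP; last by move/(closed_connect cl) <-; rewrite !inE eqxx.
by rewrite !inE => /orP[]/eqP->; [exact: connect0 | exact: connect1].
Qed.

End Graph.

(** * Adjacency in the 2-token graph *)

Section Token.

Variable G : sgraph.
Implicit Types x y z u r s : G.

Lemma token2_adjP (P Q : token2 G) :
  reflect (exists x y z, [/\ val P = [set x; y], val Q = [set x; z] & adj y z])
          (adj P Q).
Proof.
apply: (iffP idP) => [|[x [y [z [EP EQ yz]]]]]; last first.
  have := valP P; have := valP Q.
  rewrite /= /token2_adj /= EP EQ !cards2_neq => xz xy.
  suff -> : ([set x; y] :\: [set x; z]) :|: ([set x; z] :\: [set x; y])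
            = [set y; z] by rewrite adj_edges.
  have yz' := adj_neq yz.
  apply/setP => a; rewrite !inE.
  have [->|ax] := eqVneq a x; first by rewrite (negPf xy) (negPf xz).
  have [->|ay] := eqVneq a y; first by rewrite (negPf yz').
  by case: (a == z).
rewrite /= /token2_adj /= => /edgesP[a [b [ab E]]].
have cP : #|val P| = 2 by apply/eqP/(valP P).
have cQ : #|val Q| = 2 by apply/eqP/(valP Q).
(* The two differences are disjoint and their union is the edge [[set a; b]]. *)
have cD : #|val P :\: val Q| + #|val Q :\: val P| = 2.
  have := cardsUI (val P :\: val Q) (val Q :\: val P); rewrite E cards2 (adj_neq ab).
  move=> <-; suff -> : (val P :\: val Q) :&: (val Q :\: val P) = set0 by rewrite cards0.
  by apply/setP => c; rewrite !inE; case: (c \in val P); rewrite ?andbF.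
have iP := cardsID (val Q) (val P); have iQ := cardsID (val P) (val Q).
rewrite (setIC (val Q)) in iQ; rewrite cP in iP; rewrite cQ in iQ.
(* Each difference completes the common intersection to a 2-set; hence both differences and the
   intersection are singletons, giving [y], [z] and [x]. *)
have eD : #|val P :\: val Q| = #|val Q :\: val P|.
  by apply: (@addnI #|val P :&: val Q|); rewrite iP iQ.
have D1 : #|val P :\: val Q| = 1.
  by move: cD; rewrite -eD addnn; case: #|_| => [|[|n]].
have D2 : #|val Q :\: val P| = 1 by rewrite -eD.
have I1 : #|val P :&: val Q| = 1 by move: iP; rewrite D1 addn1 => -[].
case/eqP/cards1P: D1 => y Py; case/eqP/cards1P: D2 => z Qz.
case/eqP/cards1P: I1 => x Ix.
exists x, y, z; split.
- by rewrite -Ix -Py setID.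
- by rewrite -Ix -Qz setIC setID.
by rewrite -adj_edges -Py -Qz E adj_edges.
Qed.

(** * Classes of the partition and the two conditions on [E] *)

Section Partition.

Variables (k : nat) (V : 'I_k -> {set G}).
Hypothesis V_part : vertex_partition V.

Lemma block_exists x : exists i, x \in V i.
Proof.
have [_ /and3P[/eqP cov _ _]] := V_part.
have: x \in cover [set V i | i : 'I_k] by rewrite cov inE.
by case/bigcupP => B /imsetP[i _ ->]; exists i.
Qed.

Lemma block_uniq x i j : x \in V i -> x \in V j -> i = j.
Proof.
have [Vinj /and3P[_ triv _]] := V_part.
move=> xi xj; apply: Vinj; apply/eqP; apply: contraTT xj => ne.
have /trivIsetP/(_ (V i) (V j)) := triv.
rewrite !imset_f // => /(_ isT isT ne); rewrite disjoint_subset.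
by move/subsetP/(_ x xi).
Qed.

Lemma token2_setP (E : {set {set G}}) (P : token2 G) :
  reflect ((exists i, val P \subset V i) \/ val P \in E)
          (P \in token2_set V E).
Proof.
rewrite !inE; apply: (iffP orP) => -[h|h]; [left|by right|left|by right].
  by case/bigcupP: h => i _; rewrite inE => /andP[h _]; exists i.
by case: h => i h; apply/bigcupP; exists i => //; rewrite inE h (valP P).
Qed.

Lemma edges_isolatedP (E : {set {set G}}) :
  reflect (forall u r i j, [set u; r] \in E -> u \in V i -> r \in V j ->
             isolated_edge_in (V i :|: V j) [set u; r])
          (edges_isolated V E).
Proof.
apply: (iffP forallP) => [h u r i j urE ui rj|h u].
  have /forallP/(_ r)/forallP/(_ i)/forallP/(_ j)/implyP := h u.
  by apply; apply/and3P.
apply/forallP => r; apply/forallP => i; apply/forallP => j.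
by apply/implyP => /and3P[*]; apply: h.
Qed.

(** A triangle through distinct edges [[set x; y]] and [[set x; z]] can only be [[set x; y; z]], so
    it exists exactly when [y] and [z] are adjacent. The case [y = z] is harmless, as adjacency is
    irreflexive. *)
Lemma edges_triangle_freeP (E : {set {set G}}) :
  E \subset edges G ->
  reflect (forall x y z, [set x; y] \in E -> [set x; z] \in E -> ~~ adj y z)
          (edges_triangle_free E).
Proof.
move=> /subsetP sE; apply: (iffP forall_inP) => [h x y z xyE xzE|h e1 e1E].
  apply/negP => yz.
  have xy : adj x y by rewrite -adj_edges sE.
  have xz : adj x z by rewrite -adj_edges sE.
  have /forall_inP/(_ _ xzE)/implyP := h _ xyE.
  have -> : ([set x; y] != [set x; z]) && ([set x; y] :&: [set x; z] != set0).
    apply/andP; split; last by apply/set0Pn; exists x; rewrite !inE eqxx.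
    apply: contraTneq yz => /set2_inv[[_ ->]|[-> ->]]; last by rewrite adj_irrefl.
    by rewrite adj_irrefl.
  move=> /(_ isT)/existsP; apply; exists [set x; y; z].
  rewrite triangle3 //= !subUset !sub1set !inE !eqxx ?orbT //.
apply/forall_inP => e2 e2E; apply/implyP => /andP[ne /set0Pn[x]].
rewrite inE => /andP[x1 x2].
have other e : e \in E -> x \in e -> exists y, e = [set x; y].
  move=> /sE/edgesP[a [b [_ ->]]]; rewrite !inE => /orP[]/eqP->.
    by exists b.
  by exists a; rewrite setUC.
have [y e1y] := other _ e1E x1; have [z e2z] := other _ e2E x2.
apply/negP => /existsP[t /and3P[tt]]; subst e1 e2.
rewrite !subUset !sub1set => /andP[_ yt] /andP[_ zt].
have /negP := h _ _ _ e1E e2E; apply; apply: (triangle_adj tt) => //.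
by apply: contraNneq ne => ->.
Qed.

(** * Independence of A *)

Hypothesis V_indep : forall i, independent (V i).

Lemma token2_set_independent (E : {set {set G}}) :
  admissible_edges V E -> independent (token2_set V E).
Proof.
case/and3P => sE /edges_isolatedP iE /(edges_triangle_freeP sE) tE.
(* By condition (1), [x] is the only neighbour of [z] in [V i], so [y] cannot be another one. *)
have mixed i x y z :
    x != y -> [set x; y] \subset V i -> [set x; z] \in E -> ~~ adj y z.
  rewrite subUset !sub1set => /negP xy /andP[xi yi] xzE; apply/negP => yz.
  have xz : adj x z by rewrite -adj_edges (subsetP sE).
  have [j zj] := block_exists z.
  have /isolated_edgeP := iE _ _ _ _ xzE xi zj.
  case; rewrite ?inE ?xi ?zj ?orbT // => _ /(_ y).
  rewrite inE yi adj_sym => /(_ isT yz) yx.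
  by apply: xy; rewrite yx.
apply/independentP => P Q /token2_setP hP /token2_setP hQ.
apply/negP => /token2_adjP[x [y [z [EP EQ yz]]]].
have xy : x != y by rewrite -cards2_neq -EP; apply: (valP P).
have xz : x != z by rewrite -cards2_neq -EQ; apply: (valP Q).
move: hP hQ; rewrite EP EQ; case=> [[i Pi]|PE]; case=> [[j Qj]|QE].
- move: Pi Qj; rewrite !subUset !sub1set => /andP[xi yi] /andP[xj zj].
  move: zj; rewrite -(block_uniq xi xj) => zi.
  by have /independentP/(_ y z yi zi) := V_indep i; rewrite yz.
- by have := mixed _ _ _ _ xy Pi QE; rewrite yz.
- by have := mixed _ _ _ _ xz Qj PE; rewrite adj_sym yz.
- by have := tE _ _ _ PE QE; rewrite yz.
Qed.

(** * Maximality of A *)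

Hypothesis V_phi : forall i j : 'I_k, i < j -> phi (V j) (V i) = set0.

(** Otherwise adding [r] to the independent set [V i] would keep it independent and put [r] in the
    empty set [phi (V j) (V i)]. *)
Lemma phi_neighbor (i j : 'I_k) r :
  i < j -> r \in V j -> exists2 s, s \in V i & adj r s.
Proof.
move=> ij rj; apply/exists_inP; apply: contraT; rewrite negb_exists_in.
move=> /forall_inP nb; suff: r \in phi (V j) (V i) by rewrite V_phi // inE.
rewrite inE rj; apply/independentP => x y; rewrite !inE.
move=> /orP[/eqP->|xi] /orP[/eqP->|yi]; rewrite ?adj_irrefl //.
- exact: nb.
- by rewrite adj_sym; apply: nb.
- by have /independentP := V_indep i; apply.
Qed.

Section Undominated.

Variables (E : {set {set G}}) (P : token2 G).
Hypothesis P_free : {in token2_set V E, forall Q, ~~ adj P Q}.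

(** Otherwise [[set x; s]] lies inside a class, hence in A, and is a neighbour of [P] through the
    edge from [y] to [s]. *)
Lemma undominated_block i x y s :
  val P = [set x; y] -> x \in V i -> s \in V i -> adj y s -> s = x.
Proof.
move=> EP xi si ys; apply/eqP; apply: contraT => sx.
have sz : #|[set x; s]| == 2 by rewrite cards2_neq eq_sym.
pose Q : token2 G := Sub [set x; s] sz.
have QA : Q \in token2_set V E.
  by apply/token2_setP; left; exists i; rewrite subUset !sub1set xi si.
by have /token2_adjP := P_free QA; case; exists x, y, s.
Qed.

Lemma undominated_edge x y z :
  val P = [set x; y] -> [set x; z] \in E -> x != z -> ~~ adj y z.
Proof.
move=> EP xzE; rewrite -cards2_neq => sz; apply/negP => yz.
pose Q : token2 G := Sub [set x; z] sz.
have QA : Q \in token2_set V E by apply/token2_setP; right.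
by have /token2_adjP := P_free QA; case; exists x, y, z.
Qed.

Lemma undominated_isolated (i j : 'I_k) u r :
  i < j -> val P = [set u; r] -> u \in V i -> r \in V j ->
  adj u r /\ isolated_edge_in (V i :|: V j) [set u; r].
Proof.
move=> ij EP ui rj.
(* The neighbour [s] must be [u], which makes [[set u; r]] an edge. *)
have [s si rs] := phi_neighbor ij rj.
have ru : adj r u by rewrite -(undominated_block EP ui si rs).
have ur : adj u r by rewrite adj_sym.
split=> //; apply/isolated_edgeP; rewrite ?inE ?ui ?rj ?orbT //.
split=> y /setUP[yi|yj] ay.
- by have /independentP/(_ u y ui yi) := V_indep i; rewrite ay.
- by apply: (undominated_block _ rj yj ay); rewrite EP setUC.
- exact: (undominated_block EP ui yi ay).
- by have /independentP/(_ r y rj yj) := V_indep j; rewrite ay.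
Qed.

Lemma undominated_in_edges (i j : 'I_k) u r :
  maxset (admissible_edges V) E ->
  i < j -> val P = [set u; r] -> u \in V i -> r \in V j -> val P \in E.
Proof.
move=> /maxsetP[/and3P[sE /edges_isolatedP iE /(edges_triangle_freeP sE) tE] Emax].
move=> ij EP ui rj; have [ur iso] := undominated_isolated ij EP ui rj.
(* No edge of [E] meeting [P] lies in a triangle with it, since that edge would be a neighbour of
   [P] in A. *)
have free x y z : [set x; y] = val P -> [set x; z] \in E -> ~~ adj y z.
  move=> /esym xyP xzE; apply: (undominated_edge xyP xzE).
  by apply: adj_neq; rewrite -adj_edges (subsetP sE).
suff adm : admissible_edges V (val P |: E).
  by have := setU11 (val P) E; rewrite (Emax _ adm (subsetUr _ _)).
have sPE : val P |: E \subset edges G by rewrite subUset sub1set sE EP adj_edges ur.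
apply/and3P; split=> //.
  (* The endpoints of [P] may be listed in either order, but their classes are determined. *)
  apply/edges_isolatedP => x y a b; rewrite !inE => /orP[/eqP|]; last exact: iE.
  rewrite EP => /set2_inv[] [-> ->] xa yb.
    by rewrite (block_uniq xa ui) (block_uniq yb rj).
  by rewrite (block_uniq xa rj) (block_uniq yb ui) setUC (setUC [set r]).
apply/(edges_triangle_freeP sPE) => x y z; rewrite !in_setU1.
move=> /orP[/eqP xyP|xyE] /orP[/eqP xzP|xzE].
(* Both pairs are [P], which forces [y = z]. *)
- move: xyP; rewrite -xzP => /set2_inv[[_ ->]|[-> ->]]; by rewrite adj_irrefl.
- exact: (free x).
- by rewrite adj_sym; exact: (free x).
- exact: tE xyE xzE.
Qed.

Lemma undominated_in_token2_set :
  maxset (admissible_edges V) E -> P \in token2_set V E.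
Proof.
move=> Emax; apply/token2_setP.
have /cards2P[u [r [_ EP]]] := valP P.
have [i ui] := block_exists u; have [j rj] := block_exists r.
have [ij|ji|/val_inj ij] := ltngtP i j.
- by right; apply: undominated_in_edges EP ui rj.
- by right; apply: undominated_in_edges rj ui => //; rewrite EP setUC.
- by left; exists i; rewrite EP subUset !sub1set ui ij rj.
Qed.

End Undominated.

End Partition.

End Token.

Theorem theorem3p11 (G : sgraph) (k : nat) (V : 'I_k -> {set G})
  (V_part : vertex_partition V)
  (V_indep : forall i : 'I_k, independent (V i))
  (V_phi : forall i j : 'I_k, i < j -> phi (V j) (V i) = set0)
  (E : {set {set G}})
  (E_max : maxset (admissible_edges V) E) :
  maximal_independent (token2_set V E).
Proof.
apply/maxsetP; split.
  by apply: token2_set_independent => //; have /maxsetP[] := E_max.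
(* A member of an independent set [B] containing A has no neighbour in A, hence already lies in
   A. *)
move=> B /independentP Bind AB; apply/eqP; rewrite eqEsubset AB andbT.
apply/subsetP => P PB; apply: undominated_in_token2_set => // Q QA.
by apply: Bind => //; apply: (subsetP AB).
Qed.
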